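(* Let $L_1,\dots,L_m$ be pairwise linearly independent linear forms in variables $x_1,\dots,x_d$ (with integer coefficients), and let $k_1,\dots,k_d$ be positive integers. Moreover, for each $j$ with $k_j>1$, assume that no linear form $L_i$ is of the form $L_i(x_1,\dots,x_d)=ax_j$. Let $p$ be a prime. If $f_1,\dots,f_m:\mathbb{F}_p\to\mathbb{C}$ satisfy $|f_i(x)|\le1$ for each $1\le i\le m$ and each $x\in\mathbb{F}_p$, then $$\mathbb{E}_{x_1,\dots,x_d\in\mathbb{F}_p}\prod_{j=1}^m f_j\bigl(L_j(x_1^{k_1},\dots,x_d^{k_d})\bigr)=\mathbb{E}_{x_1,\dots,x_d\in\mathbb{F}_p}\prod_{j=1}^m f_j\bigl(L_j(x_1,\dots,x_d)\bigr)+O(p^{-c}).$$ In particular, for every $A\subset\mathbb{F}_p$, $$\bigl|\{(x_1,\dots,x_d)\in\mathbb{F}_p^d: L_i(x_1^{k_1},\dots,x_d^{k_d})\in A \text{ for } 1\le i\le m\}\bigr|$$ $$=\bigl|\{(x_1,\dots,x_d)\in\mathbb{F}_p^d: L_i(x_1,\dots,x_d)\in A\text{ for }1\le i\le m\}\bigr|+O(p^{d-c}).$$ Here $c>0$ and the implied constants depend on $m,d,k_1,\dots,k_d$ and $L_1,\dots,L_m$, but not on the functions $f_i$ or the set $A$.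
   Context: $\mathbb{E}_{x\in X}f(x)=\frac1{|X|}\sum_{x\in X}f(x)$. The linear forms are evaluated on $\mathbb{F}_p^d$ by reducing coefficients modulo $p$. The notation $O(g(p))$ denotes a quantity bounded in absolute value by $C|g(p)|$ for all sufficiently large primes $p$, where $C$ and the threshold on $p$ do not depend on the functions $f_i$ or the set $A$. *)

(* Defs.v *)
From HB Require Import structures.
From mathcomp Require Import all_boot all_order all_algebra.
From mathcomp Require Import complex.
From mathcomp Require Import reals exp.

Set Implicit Arguments.
Unset Strict Implicit.
Unset Printing Implicit Defensive.

Import Order.TTheory GRing.Theory Num.Theory.
Local Open Scope ring_scope.
Local Open Scope complex_scope.

Definition expectation (R : realType) (T : finType) (F : T -> R[i]) : R[i] :=
  #|T|%:R^-1 * \sum_(x : T) F x.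

(* An integer linear form is the row vector of its coefficients. *)
Definition form_eval (p d : nat) (l : 'rV[int]_d) (x : 'rV['F_p]_d) : 'F_p :=
  \sum_(j < d) (l 0 j)%:~R * x 0 j.

Definition coord_pow (p d : nat) (k : 'I_d -> nat) (x : 'rV['F_p]_d) :
  'rV['F_p]_d := \row_(j < d) x 0 j ^+ k j.

Definition rat_form (d : nat) (l : 'rV[int]_d) : 'rV[rat]_d := map_mx intr l.

(* For integer forms, independence over int and over rat agree; [free] needs
   a field. *)
Definition pairwise_lin_indep (m d : nat) (L : 'I_m -> 'rV[int]_d) : Prop :=
  forall i1 i2 : 'I_m, i1 != i2 ->
    free [:: rat_form (L i1); rat_form (L i2)].

(* Main.v *)
Require Import Defs.
From HB Require Import structures.
From mathcomp Require Import all_boot all_order all_algebra.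
From mathcomp Require Import complex.
From mathcomp Require Import reals exp.
From mathcomp Require Import cyclic separable finfield cyclotomic.
From mathcomp Require Import zify ring.

Set Implicit Arguments.
Unset Strict Implicit.
Unset Printing Implicit Defensive.

Import Order.TTheory GRing.Theory Num.Theory.
Local Open Scope ring_scope.
(** Grouping the points x by y = (x_1^k_1, ..., x_d^k_d) turns the left-hand
    average into the average of w_1(y_1) ... w_d(y_d) * prod_i f_i(L_i(y)),
    where w_j(u) counts the k_j-th roots of u ([sum_coord_pow]).  Telescoping
    the product of the weights ([prod_sub1_telescope]) leaves, for each
    coordinate t, one factor w_t(y_t) - 1, and this is a sum of fewer than k_t
    nontrivial multiplicative characters psi of order K dividing k_t
    ([pow_count_sub1]).  So the theorem reduces to a power saving for

      sum_y psi(y_t) * Phi_0(y) * prod_i f_i(L_i(y)),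

    with Phi_0 a bounded function of the coordinates other than y_t.

    The functions f_i are arbitrary, so they have to be eliminated.  As L_i is
    not a multiple of x_t, it vanishes at some vector v with v_t = 1, and
    f_i o L_i is invariant under translations along v.  The inequality of van
    der Corput along v (Cauchy-Schwarz, then differencing) removes that factor;
    it replaces psi(y_t) by psi(y_t) * conj psi(y_t + h), averaged over h, and
    the other factors by products which are invariant under the same
    translations as before.  When all the factors are gone ([vdc_bound]) there
    remains the sum over one variable

      sum_x psi(x) * prod_a psi(x + a)^(+1 or -1),  all a <> 0,

    except for O(p^-1) of the parameters h, where a shift a is zero.

    The cancellation in that sum comes from Stepanov's method.  Substituting
    1/x for x moves the simple zero of the argument at 0 to infinity: the sum
    becomes sum_y psi(f(y)) for a polynomial f of degree -1 modulo K
    ([mchar_shift_sum_poly]).  For a polynomial f whose degree is prime to K,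
    with T = (p - 1) / K, the value f(y)^T is equidistributed among the K-th
    roots of unity.  Only an upper bound for the number of y over each root of
    unity is needed, since these numbers have a known sum.  The bound
    ([stepanov_count]) results from an auxiliary polynomial that vanishes to a
    high order M at all these y and has degree about M * p / K.  In general the
    delicate point is to see that the auxiliary polynomial is not zero; here it
    is a combination of products X^b f^(eT) X^(jp) that have pairwise distinct
    degrees because deg f is prime to K.

    The one-variable sum saves p^(-1/2); each of the m + 1 uses of van der
    Corput takes a square root of the saving, whence c = 2^-(m + 2). *)

(** * Zeros of high multiplicity *)

(** In characteristic p the derivatives detect the multiplicity only below p,
    where the factorials that separate them from the Taylor coefficients are
    invertible. *)
Lemma dvdp_XsubC_derivn (F : fieldType) (p M : nat) (R : {poly F}) (x : F) :
  p \in [pchar F] -> (M <= p)%N -> (forall l, (l < M)%N -> R^`(l).[x] = 0) ->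
  ('X - x%:P) ^+ M %| R.
Proof.
move=> charF leMp dR0.
have nd0 l : (l < M)%N -> R^`N(l).[x] = 0.
  move=> ltlM; have /eqP := dR0 l ltlM.
  rewrite nderivn_def hornerMn -mulr_natr mulf_eq0 => /orP[/eqP //|].
  rewrite -(dvdn_pcharf charF) => dvd_p.
  have pr_p := pcharf_prime charF.
  suff : (p <= l)%N by move/(leq_trans leMp); rewrite leqNgt ltlM.
  elim: l {ltlM} dvd_p => [|l IHl].
    by rewrite fact0 dvdn1 => /eqP p1; rewrite p1 in pr_p.
  rewrite factS Euclid_dvdM // => /orP[/dvdn_leq|/IHl]; first exact.
  exact: leqW.
have -> : R = \sum_(i < size R) R^`N(i).[x] *: ('X - x%:P) ^+ i.
  have := @nderiv_taylor _ (map_poly polyC R) x%:P ('X - x%:P) (mulrC _ _).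
  rewrite addrC subrK -[(map_poly _ _).['X]]/(R \Po 'X) comp_polyXr => {1}->.
  rewrite size_map_polyC; apply: eq_bigr => i _.
  by rewrite nderivn_map horner_map mul_polyC.
apply: (big_ind (fun P => ('X - x%:P) ^+ M %| P)) => [|P Q|i _].
- exact: dvdp0.
- exact: dvdp_add.
case: (ltnP i M) => [ltiM | leMi]; first by rewrite nd0 // scale0r dvdp0.
by rewrite -mul_polyC dvdp_mull // dvdp_exp2l.
Qed.

Lemma mul_card_multiple_roots (F : finFieldType) (M : nat) (R : {poly F})
    (S : {set F}) :
  R != 0 -> (forall x, x \in S -> ('X - x%:P) ^+ M %| R) ->
  (#|S| * M < size R)%N.
Proof.
move=> R_neq0 dvdR; rewrite cardE.
have dvdP s : uniq s -> {subset s <= S} ->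
    \prod_(x <- s) ('X - x%:P) ^+ M %| R.
  elim: s => [|x s IHs] /=; first by rewrite big_nil dvd1p.
  case/andP=> xNs uniq_s sub_s; rewrite big_cons Gauss_dvdp.
    rewrite dvdR ?sub_s ?mem_head // IHs // => y ys.
    by rewrite sub_s // inE ys orbT.
  rewrite coprimep_expl //.
  elim: s xNs {IHs uniq_s sub_s} => [|y s IHs]; first by rewrite big_nil coprimep1.
  rewrite inE negb_or => /andP[neq_xy xNs]; rewrite big_cons coprimepMr IHs //.
  by rewrite andbT coprimep_expr // coprimep_XsubC root_XsubC eq_sym.
have sub_enum : {subset enum S <= S} by move=> x; rewrite mem_enum.
apply: leq_trans (dvdp_leq R_neq0 (dvdP _ (enum_uniq S) sub_enum)).
rewrite prodrXl.
have := size_exp (\prod_(x <- enum S) ('X - x%:P)) M.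
rewrite size_prod_XsubC /= => <-; rewrite prednK //.
rewrite size_poly_gt0 expf_eq0 negb_and -size_poly_gt0 size_prod_XsubC.
by rewrite orbT.
Qed.

(** By the pigeonhole principle two vectors have the same image, and c is
    their difference. *)
Lemma exists_kernel_vector (F : finFieldType) (I J : finType) (A : I -> J -> F) :
  (#|J| < #|I|)%N ->
  exists c : I -> F, (exists i, c i != 0) /\ forall j, \sum_i c i * A i j = 0.
Proof.
move=> ltJI; pose h (c : {ffun I -> F}) := [ffun j => \sum_i c i * A i j].
have /injectivePn[c [c' neq_c /ffunP eq_h]] : ~~ injectiveb h.
  apply/injectiveP => /leq_card; rewrite !card_ffun leqNgt.
  by rewrite ltn_exp2l ?ltJI // finNzRing_gt1.
exists (fun i => c i - c' i); split.
  case: (pickP (fun i => c i - c' i != 0)) => [i ci | c0]; first by exists i.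
  by case/eqP: neq_c; apply/ffunP => i; apply/eqP; rewrite -subr_eq0 -[_ == _]negbK c0.
move=> j; under eq_bigr do rewrite mulrBl.
by have := eq_h j; rewrite !ffunE sumrB => ->; rewrite subrr.
Qed.

(** The term of largest degree cannot be cancelled. *)
Lemma sum_distinct_size_neq0 (F : fieldType) (I : finType) (c : I -> F)
    (G : I -> {poly F}) :
  (forall i, G i != 0) -> injective (fun i => size (G i)) ->
  (exists i, c i != 0) -> \sum_i c i *: G i != 0.
Proof.
move=> G_neq0 inj_size [i0 ci0].
case: (@arg_maxnP _ i0 (fun i => c i != 0) (fun i => size (G i)) ci0) => i ci max_i.
apply: contraNneq ci => /(congr1 (coefp (size (G i)).-1)) /=.
rewrite coef0 coef_sum (bigD1 i) //= big1 => [|j neq_ji].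
  rewrite addr0 coefZ => /eqP; rewrite mulf_eq0 -/(lead_coef _) lead_coef_eq0.
  by rewrite (negPf (G_neq0 i)) orbF.
rewrite coefZ; have [->|cj] := eqVneq (c j) 0; first by rewrite mul0r.
rewrite nth_default ?mulr0 // -ltnS prednK ?size_poly_gt0 //.
rewrite ltn_neqAle; apply/andP; split; last exact: max_i.
by apply: contraNneq neq_ji => /inj_size ->.
Qed.

(** * Stepanov's method *)

(** The cofactor Q in the formula Q * f^(u - l) for the l-th derivative of
    X^b * f^u; its degree grows only by deg f for each derivative, however
    large u is. *)
Fixpoint deriv_cofactor (F : fieldType) (f : {poly F}) (u b l : nat) : {poly F} :=
  if l is l'.+1 then
    (deriv_cofactor f u b l')^`() * f
      + (deriv_cofactor f u b l' * f^`()) *+ (u - l')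
  else 'X^b.

Lemma derivn_cofactor (F : fieldType) (f : {poly F}) (u b l : nat) :
  (l <= u)%N -> ('X^b * f ^+ u)^`(l) = deriv_cofactor f u b l * f ^+ (u - l).
Proof.
elim: l => [|l IHl] ltlu; first by rewrite derivn0 subn0.
rewrite derivnS IHl; last exact: ltnW.
have [r Dr] : exists r, (u - l = r.+1)%N by exists (u - l).-1; lia.
have -> : (u - l.+1 = r)%N by lia.
rewrite derivM deriv_exp /= Dr exprS /= mulrDl mulrA; congr (_ + _).
by rewrite mulrnAr mulrnAl -!mulrA.
Qed.

Lemma size_deriv_cofactor (F : fieldType) (f : {poly F}) (n u b l : nat) :
  size f = n.+1 -> (size (deriv_cofactor f u b l) <= b + l * n + 1)%N.
Proof.
move=> size_f; elim: l => [|l IHl] /=; first by rewrite size_polyXn mul0n addn0 addn1.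
have size_deriv (g : {poly F}) : (size g^`() <= (size g).-1)%N.
  have [->|g0] := eqVneq g 0; first by rewrite deriv0 size_poly0.
  by have := lt_size_deriv g0; case: (size g).
apply: leq_trans (size_polyD _ _) _; rewrite geq_max; apply/andP; split.
  apply: leq_trans (size_polyMleq _ _) _.
  have := size_deriv (deriv_cofactor f u b l); rewrite size_f; lia.
rewrite -scaler_nat; apply: leq_trans (size_scale_leq _ _) _.
apply: leq_trans (size_polyMleq _ _) _.
have := size_deriv f; rewrite size_f; lia.
Qed.

(** X^(j p) is a constant for the derivation, while on F it is the same
    function as X^j: this is what makes the conditions on the auxiliary
    polynomial so few compared with its degree. *)
Lemma derivn_mulXpchar (F : fieldType) (p j l : nat) (Q : {poly F}) :
  p \in [pchar F] -> ('X^(j * p) * Q)^`(l) = 'X^(j * p) * Q^`(l).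
Proof.
move=> charF; elim: l => // l IHl.
rewrite derivnS IHl derivM derivXn.
have -> : 'X^((j * p).-1) *+ (j * p) = 0 :> {poly F}.
  by rewrite -mulr_natr natrM -(@polyC_natr F p) (pcharf0 charF) polyC0 !mulr0.
by rewrite mul0r add0r derivnS.
Qed.

(** The degrees of the products X^(j p) X^b f^(T e + M), for f of degree n.
    Divide such a degree, less the constant n M, by T: as p = K T + 1 and
    j + b < T, the quotient is n e + K j, which determines e modulo K since n
    is prime to K, hence j; the remainder j + b then determines b. *)
Lemma stepanov_degree_inj (K T n p s M : nat) (i i' : 'I_K * 'I_s * 'I_(T - s)) :
  coprime n K -> p = (K * T + 1)%N -> (s <= T)%N ->
  (i.1.2 * p + (i.2 + n * (T * i.1.1 + M)) =
   i'.1.2 * p + (i'.2 + n * (T * i'.1.1 + M)))%N -> i = i'.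
Proof.
case: i i' => [[e j] b] [[e' j'] b'] /= co_nK -> le_sT eq_deg.
have hb : (j + b < T)%N by have := ltn_ord j; have := ltn_ord b; lia.
have hb' : (j' + b' < T)%N by have := ltn_ord j'; have := ltn_ord b'; lia.
have T_gt0 : (0 < T)%N by lia.
have eqT : ((n * e + K * j) * T + (j + b) = (n * e' + K * j') * T + (j' + b'))%N.
  by move: eq_deg; lia.
have := congr1 (fun m => m %/ T)%N eqT.
rewrite !divnMDl // !(divn_small hb, divn_small hb') !addn0 => eq_q.
have eq_r : (j + b = j' + b')%N by move: eqT; rewrite eq_q => /addnI.
have dvd_small a a' c c' : (n * a + K * c = n * a' + K * c')%N -> (a <= a')%N ->
    (a' < K)%N -> a = a'.
  move=> eq_a le_a lt_a'; apply/eqP; rewrite eqn_leq le_a -subn_eq0.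
  apply: contraTT lt_a' => sub_neq0; rewrite -leqNgt.
  suff /dvdn_leq -/(_ _) : (K %| a' - a)%N by lia.
  rewrite -(@Gauss_dvdr _ n) 1?coprime_sym //.
  by apply/dvdnP; exists (c - c')%N; nia.
have eq_e : e = e'.
  apply: val_inj; have [le_e|/ltnW le_e] := leqP e e'.
    exact: dvd_small eq_q le_e (ltn_ord _).
  exact/esym/(dvd_small _ _ _ _ (esym eq_q) le_e (ltn_ord _)).
have eq_j : j = j'.
  apply/val_inj/eqP; move: eq_q; rewrite eq_e => /addnI/eqP.
  by rewrite eqn_pmul2l // (leq_ltn_trans _ (ltn_ord e)).
have eq_b : b = b' by apply: val_inj; move: eq_r; rewrite eq_j => /addnI.
by rewrite eq_e eq_j eq_b.
Qed.

(** The auxiliary polynomial is R = sum c_(e,j,b) X^(j p) X^b f^(T e + M) with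
    e < K, j < s, b < T - s, and M = K s - D.  At a point x with f(x)^T = z the
    l-th derivative of R is f(x)^(M - l) times the value of a polynomial E_l of
    small degree whose coefficients are linear in c.  Asking that all E_l with
    l < M vanish identically is a system of M (T + M n) linear equations in
    K s (T - s) unknowns; the lower bound on D makes the unknowns outnumber the
    equations. *)
Lemma stepanov_count (F : finFieldType) (p K T n s D : nat) (f : {poly F}) (z : F) :
  prime p -> #|F| = p -> p = (K * T + 1)%N -> (1 < K)%N ->
  size f = n.+1 -> coprime n K ->
  (s ^ 2 <= T)%N -> (K ^ 2 * n + K < D)%N -> (D <= s)%N ->
  (#|[set x | f.[x] ^+ T == z]| * (K * s - D) <= (s + n) * p + n * (K * s - D))%N.
Proof.
move=> pr_p cardF Dp K_gt1 size_f co_nK le_s2T ltD leDs.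
set M := (K * s - D)%N.
have charF : p \in [pchar F] by apply: (@card_finPcharP F p 1) => //; rewrite cardF expn1.
have le_sT : (s <= T)%N by nia.
have s_gt2 : (2 < s)%N by lia.
pose I : finType := ('I_K * 'I_s * 'I_(T - s))%type.
pose W := (T + M * n)%N.
pose u (i : I) := (T * i.1.1 + M)%N.
pose G (i : I) : {poly F} := 'X^(i.1.2 * p) * ('X^(i.2) * f ^+ u i).
pose E (i : I) l : {poly F} := z ^+ i.1.1 *: ('X^(i.1.2) * deriv_cofactor f (u i) i.2 l).
have f_neq0 : f != 0 by rewrite -size_poly_gt0 size_f.
have size_fX k : size (f ^+ k) = (n * k).+1.
  have := size_exp f k; rewrite size_f /= => <-.
  by rewrite prednK // size_poly_gt0 expf_neq0.
have X_neq0 k : 'X^k != 0 :> {poly F} by rewrite monic_neq0 ?monicXn.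
have G_neq0 i : G i != 0 by rewrite /G mulf_neq0 ?X_neq0 ?mulf_neq0 ?X_neq0 ?expf_neq0.
have size_G i : size (G i) = (i.1.2 * p + (i.2 + n * u i)).+1.
  have fu_neq0 : f ^+ u i != 0 by rewrite expf_neq0.
  have Xfu_neq0 : 'X^(i.2) * f ^+ u i != 0 by rewrite mulf_neq0 ?X_neq0.
  rewrite /G size_monicM ?monicXn // size_monicM ?monicXn // !size_polyXn size_fX.
  by rewrite !addSn !addnS.
have [|c [c_neq0 ker_c]] := @exists_kernel_vector F I ('I_M * 'I_W)%type
    (fun i j => (E i j.1)`_j.2).
  rewrite !card_prod !card_ord /W.
  have leM : (M <= K * s)%N by rewrite /M leq_subr.
  (* K s (T - s) exceeds M (T + M n) since D T > (K^2 n + K) s^2. *)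
  have h1 : (M * (M * n) <= K ^ 2 * n * s ^ 2)%N.
    apply: leq_trans (leq_mul leM (leq_mul leM (leqnn n))) _.
    by rewrite eq_leq //; ring.
  have h2 : ((K ^ 2 * n + K) * s ^ 2 < D * T)%N.
    apply: leq_ltn_trans (leq_mul (leqnn _) le_s2T) _.
    by rewrite ltn_mul2r ltD andbT; lia.
  have h3 : (M * T + D * T = K * s * T)%N by rewrite -mulnDl subnK //; nia.
  have h4 : (K * s * (T - s) + K * s ^ 2 = K * s * T)%N.
    by rewrite -mulnn mulnA -mulnDr subnK.
  by move: h2; rewrite mulnDr mulnDl; lia.
pose R := \sum_i c i *: G i.
have R_neq0 : R != 0.
  apply: sum_distinct_size_neq0 => // i i'; rewrite !size_G => -[].
  exact: stepanov_degree_inj.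
have dR0 x l : f.[x] ^+ T = z -> (l < M)%N -> R^`(l).[x] = 0.
  move=> fxT ltlM.
  have E0 : \sum_i c i *: E i l = 0.
    apply/polyP => w; rewrite coef0 coef_sum.
    have [ltwW|leWw] := ltnP w W.
      rewrite -[RHS](ker_c (Ordinal ltlM, Ordinal ltwW)).
      by apply: eq_bigr => i _; rewrite coefZ.
    apply: big1 => -[[e j] b] _; rewrite coefZ nth_default ?mulr0 //=.
    apply: leq_trans (size_scale_leq _ _) _ => /=.
    apply: leq_trans (size_polyMleq _ _) _; rewrite size_polyXn.
    apply: (@leq_trans (j.+1 + (b + l * n + 1)).-1).
      by rewrite -!subn1 leq_sub2r // leq_add2l; apply: size_deriv_cofactor.
    have := ltn_ord j; have := ltn_ord b; move: leWw; rewrite /W.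
    have : (l * n <= M * n)%N by rewrite leq_mul2r ltnW ?orbT.
    lia.
  have -> : R^`(l).[x] = f.[x] ^+ (M - l) * (\sum_i c i *: E i l).[x].
    rewrite /R raddf_sum !horner_sum mulr_sumr; apply: eq_bigr => i _.
    rewrite /= derivnZ derivn_mulXpchar // derivn_cofactor; last by rewrite /u; lia.
    rewrite /E !(hornerZ, hornerM, hornerXn, horner_exp) /u.
    rewrite -addnBA; last exact: ltnW.
    rewrite [f.[x] ^+ (_ + _)]exprD (exprM f.[x]) fxT.
    have -> : x ^+ (i.1.2 * p) = x ^+ i.1.2 by rewrite mulnC exprM -cardF expf_card.
    rewrite [RHS]mulrCA; congr (_ * _).
    by rewrite [RHS]mulrA [RHS]mulrC [f.[x] ^+ _ * _]mulrC !mulrA.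
  by rewrite E0 horner0 mulr0.
have := @mul_card_multiple_roots F M R [set x | f.[x] ^+ T == z] R_neq0.
have dvdR x : x \in [set x | f.[x] ^+ T == z] -> ('X - x%:P) ^+ M %| R.
  rewrite inE => /eqP fxT; apply: (dvdp_XsubC_derivn charF); last first.
    by move=> l; apply: dR0.
  rewrite /M; nia.
move/(_ dvdR) => lt_size; have : (size R <= (s + n) * p + n * M + 1)%N; last lia.
apply: (leq_trans (size_sum _ _ _)); apply/bigmax_leqP => i _.
apply: leq_trans (size_scale_leq _ _) _; rewrite size_G /u.
have hT : (T * i.1.1 <= p)%N by have := ltn_ord i.1.1; rewrite Dp; nia.
have hn := leq_mul (leqnn n) hT.
have hj := leq_mul (ltn_ord i.1.2) (leqnn p).
have hb := ltn_ord i.2.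
have leTp : (T <= p)%N by rewrite Dp; nia.
rewrite mulnDr [((s + n) * p)%N]mulnDl; move: hj; rewrite mulSn; lia.
Qed.

(** With D = K^2 n + K + 1, the bound of [stepanov_count] yields the error term
    D + 2 K n when s >= D; the remaining D K takes care of the case s < D by
    the trivial bound. *)
Definition stepanov_const (K n : nat) : nat :=
  ((K ^ 2 * n + K + 1) * (K + 1) + 2 * (K * n))%N.

Lemma stepanov_bound (F : finFieldType) (p K T n s : nat) (f : {poly F}) (z : F) :
  prime p -> #|F| = p -> p = (K * T + 1)%N -> (1 < K)%N ->
  size f = n.+1 -> coprime n K -> (s ^ 2 <= T)%N ->
  (s * (K * #|[set x | f.[x] ^+ T == z]|) <= (s + stepanov_const K n) * p)%N.
Proof.
move=> pr_p cardF Dp K_gt1 size_f co_nK le_s2T.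
rewrite /stepanov_const; set D := (K ^ 2 * n + K + 1)%N.
set N := #|_|; have le_Np : (N <= p)%N by rewrite -cardF max_card.
have [leDs|ltsD] := leqP D s; last first.
  have h1 : (s * (K * N) <= D * (K * p))%N.
    by rewrite leq_mul // ?leq_mul // ltnW.
  by apply: leq_trans h1 _; rewrite mulnA leq_mul2r; lia.
have ltD : (K ^ 2 * n + K < D)%N by rewrite /D addn1.
have := @stepanov_count F p K T n s D f z pr_p cardF Dp K_gt1 size_f co_nK le_s2T ltD leDs.
rewrite -/N.
set M := (K * s - D)%N => ub_N.
have le_sM : (s <= M)%N by rewrite /M; nia.
have le_Mp : (M <= p)%N.
  rewrite /M Dp; apply: leq_trans (leq_subr _ _) _.
  by apply: leq_trans (leq_addr _ _); rewrite leq_mul2l; nia.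
have [le_KN|lt_KN] := leqP (K * N) p; first by rewrite leq_mul // leq_addr.
have eqM : (M + D = K * s)%N by rewrite subnK //; nia.
have h1 : (K * N * M <= (M + D + K * n) * p + K * n * M)%N.
  have := leq_mul (leqnn K) ub_N; rewrite eqM -mulnDr -!mulnA.
  by rewrite mulnDr [(K * (_ * p))%N]mulnA.
have h2 : ((K * N - p) * M <= (D + 2 * (K * n)) * p)%N.
  have : (K * n * M <= K * n * p)%N by rewrite leq_mul.
  rewrite mulnBl; move: h1; rewrite !mulnDl; lia.
have h3 : ((K * N - p) * s <= (D + 2 * (K * n)) * p)%N.
  by apply: leq_trans h2; rewrite leq_mul.
have h4 : (D * p <= D * (K + 1) * p)%N by rewrite leq_mul // leq_pmulr // addn1.
move: h3 h4; rewrite mulnBl !mulnDl; rewrite [(s * (K * N))%N]mulnC [(p * s)%N]mulnC; lia.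
Qed.

(** * Multiplicative characters *)

Lemma finField_prim_root (F : finFieldType) :
  exists g : F, #|F|.-1.-primitive_root g.
Proof.
have F_gt1 := finNzRing_gt1 F.
suff /hasP[g _ prim_g] : has #|F|.-1.-primitive_root (enum (predC1 (0 : F))) by exists g.
apply: has_prim_root; rewrite ?enum_uniq // -?cardE ?cardC1 //.
  by case: #|F| F_gt1 => [|[]].
apply/allP => x; rewrite mem_enum unity_rootE => x_neq0.
apply/eqP/(mulfI x_neq0); rewrite mulr1 -exprS prednK ?expf_card //.
exact: ltnW.
Qed.

Lemma closedField_prim_root (C : numClosedFieldType) (n : nat) :
  (0 < n)%N -> exists w : C, n.-primitive_root w.
Proof.
move=> n_gt0; have [rs] := closed_field_poly_normal ('X^n - 1 : {poly C}).
rewrite lead_coefDl ?size_polyXn ?lead_coefXn ?scale1r; last first.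
  by rewrite size_polyN size_poly1 ltnS.
move=> Drs; suff /hasP[w _ prim_w] : has n.-primitive_root rs by exists w.
apply: has_prim_root => //.
- apply/allP => x xrs; rewrite /root_of_unity /= Drs root_prod_XsubC //.
- rewrite -separable_prod_XsubC -Drs separable_Xn_sub_1 //.
  by rewrite pnatr_eq0 -lt0n.
have := size_prod_XsubC rs id; rewrite /= -Drs size_XnsubC //.
by move=> [->].
Qed.

(** The exponent is 0 on the elements, such as 0, that are not powers of g. *)
Definition dlog (F : finFieldType) (g x : F) : nat :=
  if [pick i : 'I_#|F| | g ^+ i == x] is Some i then i else 0.

Definition mchar (F : finFieldType) (C : nzRingType) (g : F) (w : C) (x : F) : C :=
  if x == 0 then 0 else w ^+ dlog g x.

Section MultiplicativeCharacter.

Variables (F : finFieldType) (C : numClosedFieldType) (g : F) (K : nat) (w : C).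
Hypothesis prim_g : #|F|.-1.-primitive_root g.
Hypothesis prim_w : K.-primitive_root w.
Hypothesis dvdK : (K %| #|F|.-1)%N.

Local Notation psi := (mchar g w).

Lemma dlogK x : x != 0 -> g ^+ dlog g x = x.
Proof.
move=> x_neq0; rewrite /dlog; case: pickP => [i /eqP //|no_i].
have [|i Dx] := prim_rootP prim_g (_ : x ^+ #|F|.-1 = 1).
  apply/(mulfI x_neq0); rewrite mulr1 -exprS prednK ?expf_card //.
  exact: ltnW (finNzRing_gt1 F).
have lt_i : (i < #|F|)%N by apply: leq_trans (ltn_ord i) (leq_pred _).
by have := no_i (Ordinal lt_i); rewrite /= Dx eqxx.
Qed.

Lemma gen_neq0 : g != 0.
Proof. by rewrite (prim_root_eq0 prim_g) -lt0n (prim_order_gt0 prim_g). Qed.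

Lemma mchar_exp i : psi (g ^+ i) = w ^+ i.
Proof.
rewrite /mchar expf_eq0 (negPf gen_neq0) andbF.
have := dlogK (expf_neq0 i gen_neq0); move/eqP.
rewrite (eq_prim_root_expr prim_g) => /eqP eq_mod.
apply/eqP; rewrite (eq_prim_root_expr prim_w); apply/eqP.
by rewrite -(modn_dvdm _ dvdK) eq_mod modn_dvdm.
Qed.

Lemma mchar0 : psi 0 = 0. Proof. by rewrite /mchar eqxx. Qed.

Lemma mchar1 : psi 1 = 1.
Proof. by rewrite -(expr0 g) mchar_exp expr0. Qed.

Lemma mcharM x y : psi (x * y) = psi x * psi y.
Proof.
have [->|x_neq0] := eqVneq x 0; first by rewrite mul0r mchar0 mul0r.
have [->|y_neq0] := eqVneq y 0; first by rewrite mulr0 mchar0 mulr0.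
by rewrite -(dlogK x_neq0) -(dlogK y_neq0) -exprD !mchar_exp exprD.
Qed.

Lemma mcharX x n : psi (x ^+ n) = psi x ^+ n.
Proof. by elim: n => [|n IHn]; rewrite ?mchar1 // !exprS mcharM IHn. Qed.

Lemma mchar_prod (I : Type) (r : seq I) (E : I -> F) :
  psi (\prod_(i <- r) E i) = \prod_(i <- r) psi (E i).
Proof. exact: (big_morph _ mcharM mchar1). Qed.

Lemma normw : `|w| = 1.
Proof.
apply/eqP; rewrite -(pexpr_eq1 (prim_order_gt0 prim_w)) //.
by rewrite -normrX (prim_expr_order prim_w) normr1.
Qed.

Lemma norm_mchar_le1 x : `|psi x| <= 1.
Proof.
by rewrite /mchar; case: ifP => _; rewrite ?normr0 ?ler01 // normrX normw expr1n.
Qed.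

Lemma mchar_unity x : x != 0 -> psi x ^+ K = 1.
Proof.
move=> x_neq0; rewrite -(dlogK x_neq0) mchar_exp exprAC.
by rewrite (prim_expr_order prim_w) expr1n.
Qed.

Lemma conj_mchar x : (1 < K)%N -> (psi x)^* = psi (x ^+ K.-1).
Proof.
move=> K_gt1; rewrite mcharX; have [->|x_neq0] := eqVneq x 0.
  by rewrite mchar0 conjC0 expr0n; case: K K_gt1 => [|[]].
have psi_neq0 : psi x != 0.
  by rewrite -(dlogK x_neq0) mchar_exp expf_neq0 // (prim_root_eq0 prim_w) -lt0n ltnW.
have norm1 : `|psi x| = 1.
  by rewrite /mchar (negPf x_neq0) normrX normw expr1n.
apply: (mulfI psi_neq0).
by rewrite -normCK norm1 expr1n -exprS prednK ?mchar_unity // ltnW.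
Qed.

End MultiplicativeCharacter.

(** * Character sums *)

Lemma sum_prim_root_expr (C : numClosedFieldType) (K : nat) (w : C) :
  w ^+ K = 1 -> w != 1 -> \sum_(i < K) w ^+ i = 0.
Proof.
move=> wK w_neq1; have := subrX1 w K; rewrite wK subrr => /esym/eqP.
by rewrite mulf_eq0 subr_eq0 (negPf w_neq1) => /eqP.
Qed.

(** The shifts that occur in the differenced character sums; the boolean marks
    the factors that are conjugated. *)
Definition shift_prod (F : finFieldType) (C : numClosedFieldType) (psi : F -> C)
    (A : seq (F * bool)) (x : F) : C :=
  \prod_(a <- A) if a.2 then (psi (x + a.1))^* else psi (x + a.1).

Lemma leq_stepanov_const (K k n n' : nat) :
  (K <= k)%N -> (n <= n')%N -> (stepanov_const K n <= stepanov_const k n')%N.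
Proof.
move=> le_K le_n; have le_K2 : (K ^ 2 <= k ^ 2)%N by rewrite leq_exp2r.
by rewrite /stepanov_const; do !apply: leq_add => //; do !apply: leq_mul => //;
  do !apply: leq_add => //; apply: leq_mul.
Qed.

Section CharacterSum.

Variables (F : finFieldType) (C : numClosedFieldType) (g : F) (p K T : nat) (w : C).
Hypothesis prim_g : #|F|.-1.-primitive_root g.
Hypothesis prim_w : K.-primitive_root w.
Hypotheses (pr_p : prime p) (cardF : #|F| = p) (Dp : p = (K * T + 1)%N).
Hypothesis K_gt1 : (1 < K)%N.

Local Notation psi := (mchar g w).

Let dvdK : (K %| #|F|.-1)%N.
Proof. by rewrite cardF Dp addn1 dvdn_mulr. Qed.

(** Let N_i be the number of x over the i-th root of unity, so that the sum is
    sum_i w^i N_i.  Since sum_i w^i = 0, one may subtract from all N_i the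
    common upper bound of [stepanov_bound]; the differences have a constant
    sign, so the sum of their absolute values is K times the bound minus
    sum_i N_i, and the latter is at least p - n. *)
Lemma mchar_poly_sum (f : {poly F}) (n s : nat) :
  size f = n.+1 -> coprime n K -> (s ^ 2 <= T)%N ->
  s%:R * `|\sum_x psi f.[x]| <= ((stepanov_const K n + n) * p)%:R.
Proof.
move=> size_f co_nK le_s2T; set c := stepanov_const K n.
pose Z i := [set x | (f.[x] != 0) && (dlog g f.[x] %% K == i)%N].
have ub_Z i : (s * (K * #|Z i|) <= (s + c) * p)%N.
  apply: leq_trans (stepanov_bound (g ^+ (T * i)) pr_p cardF Dp K_gt1 size_f co_nK le_s2T).
  rewrite !leq_mul // subset_leq_card //; apply/subsetP => x.
  rewrite !inE => /andP[fx_neq0 /eqP Di].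
  rewrite -(dlogK prim_g fx_neq0) -exprM mulnC (eq_prim_root_expr prim_g).
  rewrite cardF Dp addn1 /= [(K * T)%N]mulnC -Di.
  by rewrite -!muln_modr modn_mod.
have K_pos : (0 < K)%N by apply: ltnW.
pose h x : 'I_K := Ordinal (ltn_pmod (dlog g f.[x]) K_pos).
have card_Z : (p - n <= \sum_(i < K) #|Z i|)%N.
  rewrite -cardF leq_subLR -[n in (n + _)%N]muln1.
  have Zf : (#|[set x | f.[x] == 0%R]| * 1 < size f)%N.
    apply: mul_card_multiple_roots; first by rewrite -size_poly_gt0 size_f.
    by move=> x; rewrite inE expr1 dvdp_XsubCl.
  rewrite size_f ltnS in Zf; rewrite -cardsT muln1.
  apply: leq_trans (leq_add Zf (leqnn _)); rewrite muln1 -leq_subLR.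
  have -> : (#|[set: F]| - #|[set x | f.[x] == 0%R]| = #|[set x | f.[x] != 0%R]|)%N.
    rewrite cardsT -(cardsC [set x | f.[x] == 0%R]) addKn.
    by apply: eq_card => x; rewrite !inE.
  rewrite -sum1_card (partition_big h xpredT) //= leq_sum // => i _.
  by rewrite sum1dep_card eq_leq //; apply: eq_card => x; rewrite !inE.
have eqS : \sum_x psi f.[x] = \sum_(i < K) w ^+ i * #|Z i|%:R.
  rewrite (bigID (fun x => f.[x] == 0)) /= big1 => [|x /eqP ->]; last exact: mchar0.
  rewrite add0r (partition_big h xpredT) //=; apply: eq_bigr => i _.
  rewrite (eq_bigr (fun _ => w ^+ i)) => [|x /andP[fx_neq0 /eqP Di]].
    by rewrite sumr_const mulr_natr; congr (_ *+ _); apply: eq_card => x; rewrite !inE.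
  by rewrite /mchar (negPf fx_neq0) -Di /= expr_mod // prim_expr_order.
have eqKsS : (s * K)%:R * \sum_x psi f.[x]
    = \sum_(i < K) w ^+ i * ((s * (K * #|Z i|))%:R - ((s + c) * p)%:R).
  under [RHS]eq_bigr do rewrite mulrBr.
  rewrite sumrB -mulr_suml sum_prim_root_expr ?prim_expr_order //; last first.
    by rewrite -[w]expr1 -(prim_order_dvd prim_w) dvdn1 gtn_eqF.
  rewrite mul0r subr0 eqS mulr_sumr; apply: eq_bigr => i _.
  by rewrite mulrCA -natrM mulnA.
have KR_gt0 : 0 < K%:R :> C by rewrite ltr0n ltnW.
rewrite -(ler_pM2l KR_gt0) mulrA -natrM [(K * s)%N]mulnC -(ger0_norm (ler0n _ _)) -normrM eqKsS.
apply: le_trans (ler_norm_sum _ _ _) _.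
under eq_bigr => i _ do
  rewrite normrM normrX (normw prim_w) expr1n mul1r distrC
    ger0_norm ?subr_ge0 ?ler_nat ?ub_Z // -natrB ?ub_Z //.
rewrite -natr_sum -natrM ler_nat sumnB; last by move=> i _; apply: ub_Z.
rewrite sum_nat_const card_ord -!big_distrr /=.
set ZZ := (\sum_(i < K) _)%N; rewrite -/ZZ in card_Z.
have le_pZ : (p <= ZZ + n)%N by lia.
have le_sp : (s <= p)%N by rewrite Dp; nia.
rewrite leq_subLR [(s * (K * ZZ))%N]mulnCA -mulnDr leq_mul2l; apply/orP; right.
rewrite !mulnDl; have := leq_mul (leqnn s) le_pZ; rewrite mulnDr.
have := leq_mul le_sp (leqnn n); lia.
Qed.

(** For y = 1/x one has x + a = (1 + a y) / y, and the total power of y may be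
    changed by a multiple of K.  As a conjugate of psi is psi^(K - 1), this
    gives f = y^q * prod_a (1 + a y)^(m_a) with q + 1 + sum_a m_a divisible by
    K.  The hypothesis a <> 0 ensures that each factor has degree 1, so that
    deg f = q + sum_a m_a is -1 modulo K.  Since q > 0, the conventions
    1/0 = 0 and psi(0) = 0 make the identity exact. *)
Lemma mchar_shift_sum_poly (A : seq (F * bool)) :
  all (fun a => a.1 != 0) A ->
  exists n (f : {poly F}), [/\ size f = n.+1, coprime n K, (n <= K + K ^ 2 * size A)%N &
    \sum_x psi x * shift_prod psi A x = \sum_x psi f.[x]].
Proof.
move=> nzA; pose m (a : F * bool) := if a.2 then K.-1 else 1%N.
pose M := (\sum_(a <- A) m a)%N.
(* The degree of f is then K (1 + M) - 1. *)
pose q := (K.-1 * (1 + M))%N.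
pose f : {poly F} := 'X^q * \prod_(a <- A) (1 + a.1 *: 'X) ^+ m a.
have K_gt0 : (0 < K)%N by apply: ltnW.
have size_lin a : a != 0 -> size (1 + a *: 'X : {poly F}) = 2.
  move=> a_neq0; rewrite addrC size_polyDl size_scale ?size_polyX //.
  by rewrite size_poly1.
have size_prod : size (\prod_(a <- A) (1 + a.1 *: 'X) ^+ m a : {poly F}) = M.+1.
  rewrite /M; elim: (A) nzA => [|a A' IHA] /=; first by rewrite !big_nil size_poly1.
  case/andP=> a_neq0 /IHA sizeA; rewrite !big_cons.
  have lin_neq0 : (1 + a.1 *: 'X : {poly F}) != 0 by rewrite -size_poly_gt0 size_lin.
  rewrite size_mul ?expf_neq0 // -?size_poly_gt0 ?sizeA //.
  have := size_exp (1 + a.1 *: 'X : {poly F}) (m a).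
  have : (0 < size ((1 + a.1 *: 'X : {poly F}) ^+ m a))%N.
    by rewrite size_poly_gt0 expf_neq0.
  by rewrite size_lin // mul1n addnS; case: (size _) => // k _ /= ->.
exists (q + M)%N, f; split.
- have prod_neq0 : \prod_(a <- A) (1 + a.1 *: 'X : {poly F}) ^+ m a != 0.
    by rewrite -size_poly_gt0 size_prod.
  by rewrite /f size_monicM ?monicXn // size_polyXn size_prod addnS.
- have -> : (q + M = K * (1 + M) - 1)%N by rewrite /q; nia.
  rewrite coprime_sym; apply/(coprime_dvdl (dvdn_mulr (1 + M) (dvdnn K))).
  by rewrite coprime_sym subn1 coprimePn //; nia.
- have leM : (M <= K * size A)%N.
    rewrite /M -sum1_size big_distrr /= leq_sum // => a _.
    by rewrite muln1 /m; case: ifP => _ //; apply: leq_pred.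
  by rewrite /q; nia.
rewrite (reindex_inj (inv_inj (@invrK F))) /=; apply: eq_bigr => y _.
have fE : f.[y] = y ^+ q * \prod_(a <- A) (1 + a.1 * y) ^+ m a.
  rewrite /f hornerM hornerXn horner_prod; congr (_ * _); apply: eq_bigr => a _.
  by rewrite horner_exp hornerD hornerC hornerZ hornerX.
have [y0|y_neq0] := eqVneq y 0.
  have q_gt0 : (0 < q)%N by rewrite muln_gt0 -subn1 subn_gt0 K_gt1.
  by rewrite fE y0 invr0 expr0n gtn_eqF // !mul0r !mchar0 mul0r.
have shiftE : psi y^-1 * shift_prod psi A y^-1
    = psi (y^-1 * \prod_(a <- A) (y^-1 + a.1) ^+ m a).
  rewrite (mcharM prim_g prim_w dvdK) (mchar_prod prim_g prim_w dvdK); congr (_ * _).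
  apply: eq_bigr => a _; rewrite /m; case: a.2; last by rewrite expr1.
  by rewrite (conj_mchar prim_g prim_w dvdK).
rewrite shiftE; set P := (_ * _).
have -> : P = f.[y] * (y ^- (1 + M)) ^+ K.
  rewrite fE /P.
  have -> : \prod_(a <- A) (y^-1 + a.1) ^+ m a
      = \prod_(a <- A) (1 + a.1 * y) ^+ m a * y ^- M.
    rewrite /M; elim: (A) => [|a A' IHA]; first by rewrite !big_nil expr0 invr1 mulr1.
    rewrite !big_cons IHA exprD invfM.
    have -> : y^-1 + a.1 = (1 + a.1 * y) * y^-1.
      by rewrite mulrDl mul1r mulfK.
    by rewrite exprMn exprVn -!mulrA; congr (_ * _); rewrite mulrCA.
  have -> : (y ^- (1 + M)) ^+ K = y ^- q * (y^-1 * y ^- M).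
    rewrite -{1}(prednK K_gt0) exprSr exprVn -exprM mulnC -/q.
    by rewrite add1n exprS invfM.
  by rewrite [RHS]mulrACA divff ?expf_neq0 // mul1r [RHS]mulrCA.
rewrite (mcharM prim_g prim_w dvdK) (mcharX prim_g prim_w dvdK).
by rewrite (mchar_unity prim_g prim_w dvdK) ?mulr1 // invr_eq0 expf_neq0.
Qed.

Lemma mchar_shift_sum_nat (A : seq (F * bool)) (s : nat) :
  all (fun a => a.1 != 0) A -> (s ^ 2 <= T)%N ->
  s%:R * `|\sum_x psi x * shift_prod psi A x| <=
    ((stepanov_const K (K + K ^ 2 * size A) + (K + K ^ 2 * size A)) * p)%:R.
Proof.
move=> nzA le_s2T; have [n [f [size_f co_nK le_n ->]]] := mchar_shift_sum_poly nzA.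
apply: le_trans (mchar_poly_sum size_f co_nK le_s2T) _.
by rewrite ler_nat leq_mul // leq_add // leq_stepanov_const.
Qed.

End CharacterSum.

Definition shift_const (k r : nat) : nat :=
  (2 * k * (stepanov_const k (k + k ^ 2 * r) + (k + k ^ 2 * r)))%N.

(** Taking for s the integer part of the square root of T, one has
    p <= (2 K s)^2, so 1 / s <= 2 K * delta whenever delta >= p^(-1/2). *)
Lemma mchar_shift_sum (F : finFieldType) (C : numClosedFieldType) (g : F)
    (k K : nat) (w delta : C) (A : seq (F * bool)) :
  #|F|.-1.-primitive_root g -> K.-primitive_root w ->
  prime #|F| -> (K %| #|F|.-1)%N -> (1 < K)%N -> (K <= k)%N ->
  all (fun a => a.1 != 0) A ->
  0 <= delta -> #|F|%:R^-1 <= delta ^+ 2 ->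
  `|\sum_x mchar g w x * shift_prod (mchar g w) A x|
    <= (shift_const k (size A))%:R * delta * #|F|%:R.
Proof.
set p := #|F| => prim_g prim_w pr_p /dvdnP[T DT] K_gt1 le_Kk nzA delta_ge0 le_delta.
have p_gt1 := prime_gt1 pr_p.
have Dp : p = (K * T + 1)%N by rewrite mulnC -DT; lia.
have T_gt0 : (0 < T)%N by nia.
have [s [s_gt0 le_s2T lt_Ts2]] : exists s, [/\ (0 < s)%N, (s ^ 2 <= T)%N & (T < s.+1 ^ 2)%N].
  have ex1 : exists s, (s ^ 2 <= T)%N by exists 1%N.
  have ub s : (s ^ 2 <= T)%N -> (s <= T)%N by nia.
  case: (ex_maxnP ex1 ub) => s le_s2T max_s; exists s; split=> //.
    exact: (max_s 1%N).
  by rewrite ltnNge; apply/negP => /max_s; rewrite ltnn.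
have := mchar_shift_sum_nat prim_g prim_w pr_p (erefl _) Dp K_gt1 nzA le_s2T.
set S := `|_|; set c := (_ + _)%N => ub_S.
have le_p : (p <= (2 * K * s) ^ 2)%N.
  have : (T.+1 <= (2 * s) ^ 2)%N by nia.
  rewrite Dp; nia.
have pR_gt0 : 0 < p%:R :> C by rewrite ltr0n ltnW.
have sR_gt0 : 0 < s%:R :> C by rewrite ltr0n.
have one_le : 1 <= (2 * K * s)%:R * delta.
  rewrite -(@ler_pXn2r _ 2) ?nnegrE ?mulr_ge0 ?ler0n // expr1n exprMn.
  have : 1 <= p%:R * delta ^+ 2 by rewrite -[X in X <= _](mulfV (lt0r_neq0 pR_gt0)) ler_pM2l.
  move/le_trans; apply; rewrite ler_wpM2r ?exprn_ge0 //.
  by rewrite -natrX ler_nat.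
rewrite -(ler_pM2l sR_gt0); apply: le_trans ub_S _.
rewrite natrM.
have le_c : (c * (2 * K) <= shift_const k (size A))%N.
  have le_n : (K + K ^ 2 * size A <= k + k ^ 2 * size A)%N.
    by apply: leq_add => //; apply: leq_mul; rewrite ?leq_exp2r.
  rewrite /shift_const mulnC; apply: leq_mul; first exact: leq_mul.
  by apply: leq_add => //; apply: leq_stepanov_const.
rewrite !mulrA ler_wpM2r ?ler0n //.
apply: le_trans (ler_peMr (ler0n _ c) one_le) _.
rewrite mulrA ler_wpM2r // -!natrM ler_nat mulnA mulnC leq_mul //.
Qed.

(** * Counting k-th roots *)

Definition pow_count (F : finFieldType) (k : nat) (y : F) : nat :=
  #|[set x : F | x ^+ k == y]|.

Lemma pow_count_le (F : finFieldType) (k : nat) (y : F) :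
  (0 < k)%N -> (pow_count k y <= k)%N.
Proof.
move=> k_gt0; rewrite -ltnS -[pow_count _ _]muln1 -(size_XnsubC y k_gt0).
apply: mul_card_multiple_roots; first by rewrite -size_poly_gt0 size_XnsubC.
by move=> x; rewrite inE expr1 dvdp_XsubCl /root hornerD hornerN hornerXn hornerC subr_eq0.
Qed.

Section PowCount.

Variables (F : finFieldType) (C : numClosedFieldType) (g : F) (W : C) (k : nat).
Hypothesis prim_g : #|F|.-1.-primitive_root g.
Hypothesis prim_W : #|F|.-1.-primitive_root W.
Hypothesis k_gt0 : (0 < k)%N.

Local Notation n := #|F|.-1.

Lemma sum_unity_root_expr (z : C) :
  z ^+ n = 1 -> \sum_(i < n) z ^+ i = (if z == 1 then n else 0)%:R.
Proof.
case: eqP => [-> _ | /eqP z_neq1 zn]; last exact: sum_prim_root_expr.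
by under eq_bigr do rewrite expr1n; rewrite sumr_const card_ord.
Qed.

(** Orthogonality used twice: the sum over all p - 1 characters psi of
    psi(y) * conj psi(x^k) detects x^k = y, and then the sum over x of
    conj psi(x^k) vanishes unless psi^k = 1. *)
Lemma pow_count_unit (y : F) : y != 0 ->
  (pow_count k y)%:R = \sum_(r < n | (W ^+ r) ^+ k == 1) mchar g (W ^+ r) y :> C.
Proof.
move=> y_neq0; set j := dlog g y; have Dy : g ^+ j = y by apply: dlogK.
have n_gt0 := prim_order_gt0 prim_g.
have nR_neq0 : n%:R != 0 :> C by rewrite pnatr_eq0 -lt0n.
have Wn := prim_expr_order prim_W.
have W_neq0 : W != 0 by rewrite (prim_root_eq0 prim_W) -lt0n.
apply: (mulfI nR_neq0).
have -> : (pow_count k y)%:R = \sum_(a < n) (W ^+ j / W ^+ (k * a) == 1)%:R :> C.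
  have -> : pow_count k y = #|[set a : 'I_n | W ^+ j / W ^+ (k * a) == 1]|.
    rewrite -(card_imset _ (_ : injective (fun a : 'I_n => g ^+ a))); last first.
      move=> a b /eqP; rewrite (eq_prim_root_expr prim_g) !modn_small // => /eqP.
      exact: val_inj.
    have eq_a a : (W ^+ j / W ^+ (k * a) == 1) = ((g ^+ a) ^+ k == y).
      rewrite -Dy -exprM mulnC (eq_prim_root_expr prim_g) eq_sym.
      rewrite -(eq_prim_root_expr prim_W) mulnC eq_sym.
      by rewrite -(inj_eq (mulIf (expf_neq0 (k * a) W_neq0))) mulfVK ?expf_neq0 // mul1r.
    apply: eq_card => x; rewrite inE; apply/eqP/imsetP => [xk|[a]].
      have x_neq0 : x != 0.
        by apply: contraNneq y_neq0 => x0; rewrite -xk x0 expr0n gtn_eqF.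
      have ltn : (dlog g x %% n < n)%N by rewrite ltn_pmod.
      exists (Ordinal ltn); last by rewrite /= expr_mod ?dlogK // (prim_expr_order prim_g).
      by rewrite inE eq_a /= expr_mod ?dlogK ?xk // (prim_expr_order prim_g).
    by rewrite inE eq_a => /eqP xk ->.
  rewrite -sum1_card natr_sum big_mkcond /=; apply: eq_bigr => a _.
  by rewrite inE; case: ifP.
rewrite mulr_sumr.
under eq_bigr => a _.
  have -> : n%:R * (W ^+ j / W ^+ (k * a) == 1)%:R = \sum_(r < n) (W ^+ j / W ^+ (k * a)) ^+ r.
    rewrite sum_unity_root_expr.
      by case: ifP; rewrite ?mulr1 ?mulr0.
    by rewrite exprMn exprVn !(exprAC W _ n) Wn !expr1n invr1 mulr1.
  over.
rewrite exchange_big mulr_sumr big_mkcond [RHS]big_mkcond /=; apply: eq_bigr => r _.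
under eq_bigr do rewrite exprMn exprVn -exprM -exprM.
rewrite -mulr_sumr.
have -> : \sum_(a < n) (W ^+ (k * a * r))^-1 = \sum_(a < n) ((W ^+ r) ^+ k)^-1 ^+ a.
  by apply: eq_bigr => a _; rewrite exprVn -!exprM; congr (_ ^- _); lia.
rewrite sum_unity_root_expr; last by rewrite exprVn !(exprAC _ _ n) Wn !expr1n invr1.
rewrite invr_eq1; case: ifP => _; last by rewrite mulr0.
rewrite mulrC; congr (_ * _).
rewrite -Dy; rewrite /mchar expf_eq0 (negPf (gen_neq0 prim_g)) andbF Dy -/j.
by rewrite -exprM mulnC.
Qed.

Lemma pow_count_sub1 (y : F) :
  (pow_count k y)%:R - 1 =
    \sum_(r < n | ((W ^+ r) ^+ k == 1) && (W ^+ r != 1)) mchar g (W ^+ r) y :> C.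
Proof.
have [->|y_neq0] := eqVneq y 0.
  rewrite big1 => [|r _]; last by rewrite /mchar eqxx.
  rewrite (_ : pow_count k 0 = 1%N) ?subrr // -[RHS](cards1 (0 : F)).
  by apply: eq_card => x; rewrite !inE expf_eq0 k_gt0.
rewrite pow_count_unit // (bigD1 (Ordinal (prim_order_gt0 prim_g))) /=; last first.
  by rewrite expr0 expr1n.
rewrite {1}/mchar (negPf y_neq0) expr0 expr1n addrC addrK.
apply: eq_bigl => r; congr (_ && ~~ _).
by rewrite -(prim_order_dvd prim_W) /dvdn modn_small // -val_eqE.
Qed.

(** At y = 1 each character takes the value 1, so the number of characters,
    with the trivial one, is the number of k-th roots of 1. *)
Lemma card_pow_chars :
  (#|[pred r : 'I_n | ((W ^+ r) ^+ k == 1) && (W ^+ r != 1)]%R| <= k)%N.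
Proof.
apply: leq_trans (pow_count_le (1 : F) k_gt0).
apply: (@leq_trans #|[pred r : 'I_n | (W ^+ r) ^+ k == 1]%R|).
  by apply: subset_leq_card; apply/subsetP => r; rewrite !inE => /andP[].
rewrite -(ler_nat C) pow_count_unit ?oner_eq0 // -sum1_card natr_sum.
rewrite ler_sum // => r _.
have dvd_n : (n %| dlog g 1%R)%N.
  by rewrite (prim_order_dvd prim_g) dlogK ?oner_neq0.
rewrite /mchar oner_eq0 exprAC (eqP (_ : W ^+ dlog g 1 == 1)) ?expr1n //.
by rewrite -(prim_order_dvd prim_W).
Qed.

End PowCount.

(** * The inequality of van der Corput *)

Lemma sqr_sum_le_card (C : numDomainType) (I : finType) (x : I -> C) :
  (forall i, x i \is Num.real) ->
  (\sum_i x i) ^+ 2 <= #|I|%:R * \sum_i x i ^+ 2.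
Proof.
move=> x_real.
have : 0 <= \sum_i \sum_j (x i - x j) ^+ 2.
  by do 2!apply: sumr_ge0 => ? _; apply: real_exprn_even_ge0; rewrite ?rpredB.
have -> : \sum_i \sum_j (x i - x j) ^+ 2
    = (#|I|%:R * \sum_i x i ^+ 2 - (\sum_i x i) ^+ 2) *+ 2.
  have sq_l : \sum_(i : I) \sum_(j : I) x i ^+ 2 = #|I|%:R * \sum_i x i ^+ 2.
    by rewrite mulr_sumr; apply: eq_bigr => i _; rewrite sumr_const mulr_natl.
  have sq_r : \sum_(i : I) \sum_(j : I) x j ^+ 2 = #|I|%:R * \sum_i x i ^+ 2.
    by rewrite exchange_big.
  have cross : \sum_(i : I) \sum_(j : I) x i * x j = (\sum_i x i) ^+ 2.
    by rewrite expr2 mulr_suml; apply: eq_bigr => i _; rewrite mulr_sumr.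
  rewrite mulrnBl mulr2n -{1}sq_l -sq_r -cross -big_split -sumrMnl -sumrB /=.
  apply: eq_bigr => i _; rewrite -big_split -sumrMnl -sumrB /=.
  by apply: eq_bigr => j _; rewrite sqrrB addrAC.
by rewrite pmulrn_lge0 // subr_ge0.
Qed.

Lemma norm_sum_le_card (C : numDomainType) (I : finType) (x : I -> C) :
  (forall i, `|x i| <= 1) -> `|\sum_i x i| <= #|I|%:R.
Proof.
move=> x_le1; apply: le_trans (ler_norm_sum _ _ _) _.
by rewrite -sum1_card natr_sum ler_sum.
Qed.

Section VanDerCorput.

Variables (F : finFieldType) (C : numClosedFieldType) (d : nat).
Local Notation V := 'rV[F]_d.

Lemma sum_shift_line (G : V -> C) (v : V) :
  #|F|%:R * \sum_y G y = \sum_y \sum_(t : F) G (y + t *: v).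
Proof.
rewrite exchange_big /= -sum1_card natr_sum mulr_suml; apply: eq_bigr => t _.
by rewrite mul1r (reindex_inj (addIr (t *: v))).
Qed.

(** Averaging over translations along v, under which Phi does not change,
    replaces G by its sum H on the lines of direction v.  Cauchy-Schwarz then
    discards Phi, and the square of H expands into the correlations of G with
    its translates. *)
Lemma van_der_corput (v : V) (Phi G : V -> C) :
  (forall y t, Phi (y + t *: v) = Phi y) -> (forall y, `|Phi y| <= 1) ->
  #|F|%:R * `|\sum_y Phi y * G y| ^+ 2
    <= #|{: V}|%:R * \sum_(h : F) `|\sum_y G y * (G (y + h *: v))^*|.
Proof.
move=> inv_Phi le1_Phi; set q : C := #|F|%:R; set S := \sum_y Phi y * G y.
have q_gt0 : 0 < q by rewrite ltr0n ltnW // finNzRing_gt1.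
pose H y := \sum_(t : F) G (y + t *: v).
have qS : q * S = \sum_y Phi y * H y.
  rewrite (sum_shift_line _ v); apply: eq_bigr => y _.
  by rewrite mulr_sumr; apply: eq_bigr => t _; rewrite inv_Phi.
have le_qS : (q * `|S|) ^+ 2 <= #|{: V}|%:R * \sum_y `|H y| ^+ 2.
  apply: le_trans (sqr_sum_le_card (fun y => normr_real (H y))).
  rewrite ler_pXn2r ?nnegrE ?mulr_ge0 ?ler0n ?sumr_ge0 //.
  rewrite -(ger0_norm (ltW q_gt0)) -normrM qS.
  apply: le_trans (ler_norm_sum _ _ _) _; apply: ler_sum => y _.
  by rewrite normrM ler_piMl.
have sumH : \sum_y `|H y| ^+ 2 = q * \sum_(h : F) \sum_y G y * (G (y + h *: v))^*.
  have -> : \sum_y `|H y| ^+ 2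
      = \sum_y \sum_(t : F) \sum_(h : F) G (y + t *: v) * (G (y + t *: v + h *: v))^*.
    apply: eq_bigr => y _; rewrite normCK /H rmorph_sum mulr_suml.
    apply: eq_bigr => t _; rewrite mulr_sumr (reindex_inj (addrI t)) /=.
    by apply: eq_bigr => h _; rewrite scalerDl addrA.
  rewrite -(sum_shift_line (fun y => \sum_(h : F) G y * (G (y + h *: v))^*)).
  by rewrite exchange_big.
rewrite -(ler_pM2l q_gt0) mulrA -expr2 -exprMn.
apply: le_trans le_qS _; rewrite mulrCA ler_wpM2l // sumH ler_wpM2l ?(ltW q_gt0) //.
have H_ge0 : 0 <= \sum_(h : F) \sum_y G y * (G (y + h *: v))^*.
  by rewrite -(pmulr_rge0 _ q_gt0) -sumH sumr_ge0 // => y _; rewrite exprn_ge0.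
by rewrite -(ger0_norm H_ge0); apply: ler_norm_sum.
Qed.

Lemma sum_coord (j : 'I_d) (h : F -> C) :
  #|F|%:R * \sum_(y : V) h (y 0 j) = #|{: V}|%:R * \sum_x h x.
Proof.
rewrite (sum_shift_line _ (delta_mx 0 j)) -[#|_|%:R in RHS]mulr1 -mulrA mul1r.
rewrite -sum1_card natr_sum mulr_suml; apply: eq_bigr => y _.
rewrite mul1r [RHS](reindex_inj (addrI (y 0 j))); apply: eq_bigr => t _.
by rewrite !mxE !eqxx mulr1.
Qed.

(** Differencing by h doubles the product over A and adds the shift h itself,
    coming from the distinguished shift 0. *)
Definition shift_double (h : F) (A : seq (F * bool)) : seq (F * bool) :=
  A ++ (h, true) :: [seq (a.1 + h, ~~ a.2) | a <- A].

Lemma shift_double_prod (psi : F -> C) (h : F) (A : seq (F * bool)) (x : F) :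
  (psi x * shift_prod psi A x) * (psi (x + h) * shift_prod psi A (x + h))^*
    = psi x * shift_prod psi (shift_double h A) x.
Proof.
rewrite /shift_prod big_cat big_cons big_map /= rmorphM rmorph_prod -!mulrA.
congr (_ * (_ * (_ * _))); apply: eq_bigr => a _.
by rewrite -addrA [h + _]addrC; case: a.2; rewrite //= conjCK.
Qed.

Fixpoint vdc_const (b : nat -> nat) (s n : nat) : nat :=
  if s is s'.+1 then (n.+1 + vdc_const b s' (n + n.+1))%N else b n.

(** Induction on the number s of factors to remove.  The distinguished factor
    psi(x) at the shift 0 must stay isolated; differencing by h keeps it so
    unless h is 0 or the opposite of a shift in A, that is for all but
    size A + 1 values of h.  The factors are indexed by nat only so that the
    last one can be split off. *)
Lemma vdc_bound (b : nat -> nat) (psi : F -> C) (j : 'I_d) :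
  (forall x, `|psi x| <= 1) ->
  (forall A delta, all (fun a => a.1 != 0) A -> 0 <= delta -> #|F|%:R^-1 <= delta ^+ 2 ->
    `|\sum_x psi x * shift_prod psi A x| <= (b (size A))%:R * delta * #|F|%:R) ->
  forall s A (v : nat -> V) (Phi : nat -> V -> C) (delta : C),
  all (fun a => a.1 != 0) A ->
  (forall i, v i 0 j = 1) -> (forall i y t, Phi i (y + t *: v i) = Phi i y) ->
  (forall i y, `|Phi i y| <= 1) ->
  0 <= delta -> delta <= 1 -> #|F|%:R^-1 <= delta ^+ (2 ^ s.+1) ->
  `|\sum_(y : V) psi (y 0 j) * shift_prod psi A (y 0 j) * \prod_(i < s) Phi i y|
    <= (vdc_const b s (size A))%:R * delta * #|{: V}|%:R.
Proof.
move=> psi_le1 base; set q : C := #|F|%:R.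
have q_gt0 : 0 < q by rewrite ltr0n ltnW // finNzRing_gt1.
have shift_le1 A x : `|psi x * shift_prod psi A x| <= 1.
  rewrite normrM mulr_ile1 // normr_prod.
  by apply: prodr_ile1 => -[a []] _; rewrite normr_ge0 ?norm_conjC psi_le1.
elim=> [|s IHs] A v Phi delta nzA vj inv_Phi le1_Phi d_ge0 d_le1 le_d.
  under eq_bigr do rewrite big_ord0 mulr1.
  rewrite -(ler_pM2l q_gt0) -[q in X in X <= _](ger0_norm (ltW q_gt0)) -normrM.
  rewrite (sum_coord j (fun x => psi x * shift_prod psi A x)) normrM ger0_norm //.
  rewrite mulrA mulrC ler_wpM2r // mulrC; exact: base.
set G := fun y : V => psi (y 0 j) * shift_prod psi A (y 0 j) * \prod_(i < s) Phi i y.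
have -> : \sum_(y : V) psi (y 0 j) * shift_prod psi A (y 0 j) * \prod_(i < s.+1) Phi i y
   = \sum_y Phi s y * G y.
  by apply: eq_bigr => y _; rewrite big_ord_recr /= mulrA mulrC.
set S := `|_|; set c := vdc_const b s (size A + (size A).+1).
set N : C := #|{: V}|%:R.
have vdc := van_der_corput G (inv_Phi s) (le1_Phi s).
(* The values of h for which only the trivial bound is available. *)
pose bad (h : F) := ~~ all (fun a => a.1 != 0) (shift_double h A).
have card_bad : (#|[pred h | bad h]| <= (size A).+1)%N.
  rewrite -[size A](size_map (fun a => - a.1) A).
  apply: leq_trans (card_size (0 :: [seq - a.1 | a <- A])).
  apply: subset_leq_card; apply/subsetP => h; rewrite !inE /bad.
  apply: contraR; rewrite negb_or => /andP[h_neq0 hNA].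
  rewrite /shift_double all_cat nzA /= h_neq0 /=; apply/allP => _ /mapP[a aA ->] /=.
  apply: contra hNA => /eqP ah; apply/mapP; exists a => //.
  by apply/eqP; rewrite -addr_eq0 addrC ah.
have GG h y : G y * (G (y + h *: v s))^* =
    psi (y 0 j) * shift_prod psi (shift_double h A) (y 0 j)
      * \prod_(i < s) (Phi i y * (Phi i (y + h *: v s))^*).
  have prodE : \prod_(i < s) (Phi i (y + h *: v s))^* = (\prod_(i < s) Phi i (y + h *: v s))^*.
    by rewrite rmorph_prod.
  by rewrite -shift_double_prod big_split /= prodE /G !rmorphM !mxE vj mulr1 [LHS]mulrACA.
have N_ge0 : 0 <= N by apply: ler0n.
have le_T h : `|\sum_y G y * (G (y + h *: v s))^*|
    <= (if bad h then 1 else 0) * N + c%:R * delta ^+ 2 * N.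
  under eq_bigr do rewrite GG.
  case: ifPn => [_ | /negPn nz_h].
    rewrite mul1r; apply: le_trans (norm_sum_le_card _) _ => [y|].
      rewrite normrM mulr_ile1 // normr_prod; apply: prodr_ile1 => i _.
      by rewrite normr_ge0 normrM norm_conjC mulr_ile1.
    by rewrite lerDl !mulr_ge0 ?exprn_ge0.
  rewrite mul0r add0r.
  have -> : c = vdc_const b s (size (shift_double h A)).
    by rewrite size_cat /= size_map.
  apply: (IHs _ v (fun i y => Phi i y * (Phi i (y + h *: v s))^*)) => //.
  - by move=> i y t; rewrite inv_Phi addrAC inv_Phi.
  - by move=> i y; rewrite normrM norm_conjC mulr_ile1.
  - exact: exprn_ge0.
  - by rewrite exprn_ile1.
  by rewrite -exprM -expnS.
have le_S2 : S ^+ 2 <= ((size A).+1 + c)%:R * delta ^+ 2 * N ^+ 2.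
  rewrite -(ler_pM2l q_gt0); apply: le_trans vdc _.
  apply: (@le_trans _ _ (N * \sum_(h : F) ((if bad h then 1 else 0) * N + c%:R * delta ^+ 2 * N))).
    by rewrite ler_wpM2l // ler_sum.
  rewrite big_split /= -mulr_suml -big_mkcond /= sumr_const.
  have -> : \sum_(h : F) c%:R * delta ^+ 2 * N = q * (c%:R * delta ^+ 2 * N).
    by rewrite sumr_const -[LHS]mulr_natl.
  (* The trivial bound for the bad h costs (size A + 1) / q <= (size A + 1) delta^2. *)
  have le_inv : 1 <= q * delta ^+ 2.
    rewrite -[X in X <= _](mulfV (lt0r_neq0 q_gt0)) ler_pM2l //.
    apply: le_trans le_d _; rewrite ler_wiXn2l //.
    by rewrite expnS leq_pmulr // expn_gt0.
  rewrite natrD.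
  have -> : q * (((size A).+1%:R + c%:R) * delta ^+ 2 * N ^+ 2)
     = N * ((size A).+1%:R * (q * delta ^+ 2) * N + q * (c%:R * delta ^+ 2 * N)) by ring.
  rewrite ler_wpM2l // lerD2r ler_wpM2r //.
  apply: (@le_trans _ _ (size A).+1%:R); first by rewrite ler_nat.
  by rewrite ler_peMr.
have S_ge0 : 0 <= S by apply: normr_ge0.
have R_ge0 : 0 <= (vdc_const b s.+1 (size A))%:R * delta * N by rewrite !mulr_ge0.
rewrite -(@ler_pXn2r _ 2) ?nnegrE //; apply: le_trans le_S2 _.
rewrite !exprMn ler_wpM2r ?exprn_ge0 // ler_wpM2r ?exprn_ge0 //.
by rewrite -natrX ler_nat -mulnn /= leq_pmulr.
Qed.

End VanDerCorput.

(** * Equidistribution of powers in linear forms *)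

Lemma sum_coord_pow (C : comNzRingType) (p d : nat) (k : 'I_d -> nat)
    (G : 'rV['F_p]_d -> C) :
  \sum_x G (coord_pow k x) =
    \sum_(y : 'rV['F_p]_d) (\prod_j (pow_count (k j) (y 0 j))%:R) * G y.
Proof.
have count (y : 'rV['F_p]_d) : \prod_j (pow_count (k j) (y 0 j))%:R
    = \sum_(x | coord_pow k x == y) 1 :> C.
  under eq_bigr => j _.
    rewrite /pow_count -sum1_card natr_sum big_mkcond /=.
    over.
  rewrite bigA_distr_bigA [RHS]big_mkcond /=.
  rewrite (reindex (fun x : 'rV['F_p]_d => [ffun j => x 0 j])) /=; last first.
    exists (fun h : {ffun 'I_d -> 'F_p} => \row_j h j) => [x _|h _].
      by apply/rowP => j; rewrite !(mxE, ffunE).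
    by apply/ffunP => j; rewrite !(mxE, ffunE).
  apply: eq_bigr => x _; case: eqP => [<-|ne_y].
    by apply: big1 => j _; rewrite ffunE inE mxE eqxx.
  have /existsP[j ne_j] : [exists j, x 0 j ^+ k j != y 0 j].
    apply: contra_notT ne_y => /existsPn eq_y.
    by apply/rowP => j; rewrite mxE; apply/eqP/negPn/eq_y.
  by rewrite (bigD1 j) //= ffunE inE (negPf ne_j) mul0r.
rewrite (partition_big (coord_pow k) xpredT) //=; apply: eq_bigr => y _.
rewrite count mulr_suml; apply: eq_bigr => x /eqP ->; exact/esym/mul1r.
Qed.

Lemma prod_sub1_telescope (C : comNzRingType) (d : nat) (a : 'I_d -> C) :
  \prod_j a j - 1 = \sum_(t < d) (\prod_(j < d | (j < t)%N) a j) * (a t - 1).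
Proof.
pose A t := \prod_(j < d | (j < t)%N) a j.
have -> : \prod_j a j = A d by apply: eq_bigl => j; rewrite ltn_ord.
have A0 : A 0%N = 1 by apply: big_pred0.
rewrite -[X in _ - X = _]A0 -telescope_sumr // big_mkord; apply: eq_bigr => t _.
rewrite mulrBr mulr1 -/(A t); congr (_ - _).
rewrite /A (bigD1 t) //= mulrC; congr (_ * _); apply: eq_bigl => j.
by rewrite ltnS ltn_neqAle andbC.
Qed.

Lemma form_evalD (p d : nat) (l : 'rV[int]_d) (x y : 'rV['F_p]_d) (t : 'F_p) :
  form_eval l (x + t *: y) = form_eval l x + t * form_eval l y.
Proof.
rewrite /form_eval mulr_sumr -big_split /=; apply: eq_bigr => j _.
by rewrite !mxE mulrDr mulrCA.
Qed.

(** The vector e_i - (l_i / l_j) e_j; by the bound on l_j the denominator is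
    nonzero modulo p. *)
Lemma form_eval_kernel (p d : nat) (l : 'rV[int]_d) (i j : 'I_d) :
  prime p -> (`|l 0%R j| < p)%N -> l 0 j != 0 -> j != i ->
  exists v : 'rV['F_p]_d, v 0 i = 1 /\ form_eval l v = 0.
Proof.
move=> pr_p lt_p lj_neq0 ne_ji.
have l_neq0 : (l 0 j)%:~R != 0 :> 'F_p.
  rewrite -(dvdz_pcharf (pchar_Fp pr_p)) /dvdz /=.
  apply: contraL lt_p => /dvdn_leq; rewrite absz_gt0 -leqNgt; exact.
pose c : 'F_p := (l 0 i)%:~R / (l 0 j)%:~R.
exists (delta_mx 0 i + (- c) *: delta_mx 0 j); split.
  by rewrite !mxE !eqxx /= eq_sym (negPf ne_ji) mulr0 addr0.
have form_delta (r : 'I_d) : form_eval l (delta_mx 0 r : 'rV['F_p]_d) = (l 0 r)%:~R.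
  rewrite /form_eval (bigD1 r) //= big1 => [|s ne_s]; rewrite !mxE ?eqxx ?mulr1 ?addr0 //.
  by rewrite (negPf ne_s) mulr0.
by rewrite form_evalD !form_delta mulNr divfK // subrr.
Qed.

Definition char_const (m kk : nat) : nat := vdc_const (shift_const kk) m.+1 0.

(** The directions that kill the factors are kernel vectors of the L_i and, for
    the additional factor Phi0, the axis t. *)
Lemma mchar_form_bound (C : numClosedFieldType) (p m d kk K : nat)
    (L : 'I_m -> 'rV[int]_d) (t : 'I_d) (g : 'F_p) (w : C)
    (f : 'I_m -> 'F_p -> C) (Phi0 : 'rV['F_p]_d -> C) (delta : C) :
  prime p -> p.-1.-primitive_root g -> K.-primitive_root w ->
  (K %| p.-1)%N -> (1 < K)%N -> (K <= kk)%N ->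
  (forall i, exists v : 'rV['F_p]_d, v 0 t = 1 /\ form_eval (L i) v = 0) ->
  (forall i x, `|f i x| <= 1) ->
  (forall y c, Phi0 (y + c *: delta_mx 0 t) = Phi0 y) -> (forall y, `|Phi0 y| <= 1) ->
  0 <= delta -> delta <= 1 -> p%:R^-1 <= delta ^+ (2 ^ m.+2) ->
  `|\sum_(y : 'rV['F_p]_d) mchar g w (y 0 t) *
      (Phi0 y * \prod_(i < m) f i (form_eval (L i) y))|
    <= (char_const m kk)%:R * delta * (p ^ d)%:R.
Proof.
move=> pr_p prim_g prim_w dvdK K_gt1 le_K exv f_le1 inv0 le0 d_ge0 d_le1 le_d.
have cardF : #|'F_p| = p := card_Fp pr_p.
have [v vP] := fin_all_exists exv.
(* The index m, like all indices outside 'I_m, is that of Phi0. *)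
pose vn n := if insub n is Some i then v i else delta_mx 0 t.
pose Phi n y := if insub n is Some i then f i (form_eval (L i) y) else Phi0 y.
have := @vdc_bound 'F_p C d (shift_const kk) (mchar g w) t _ _ m.+1 [::] vn Phi delta.
rewrite cardF card_mx cardF mul1n => vdc.
rewrite (eq_bigr (fun y : 'rV['F_p]_d => mchar g w (y 0 t) *
    shift_prod (mchar g w) [::] (y 0 t) * \prod_(i < m.+1) Phi i y)).
  apply: vdc => //.
  - by move=> x; apply: (norm_mchar_le1 g prim_w).
  - move=> A eta nzA eta_ge0 le_eta.
    have := @mchar_shift_sum 'F_p C g kk K w eta A; rewrite cardF; exact.
  - rewrite /vn => i; case: insubP => [i' _ _|_]; first by case: (vP i').
    by rewrite mxE !eqxx.
  - rewrite /vn /Phi => i y c; case: insubP => [i' _ _|_]; last exact: inv0.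
    by rewrite form_evalD; case: (vP i') => _ ->; rewrite mulr0 addr0.
  by rewrite /Phi => i y; case: insubP.
move=> y _; rewrite {1}/shift_prod big_nil mulr1; congr (_ * _).
rewrite big_ord_recr /= mulrC {2}/Phi insubN ?ltnn //; congr (_ * _).
by apply: eq_bigr => i _; rewrite /Phi valK.
Qed.

(** When k_t = 1 the factor is identically 0, which is why kernel vectors are
    only required for k_t > 1. *)
Lemma pow_term_bound (C : numClosedFieldType) (p m d kk : nat) (k : 'I_d -> nat)
    (L : 'I_m -> 'rV[int]_d) (t : 'I_d)
    (f : 'I_m -> 'F_p -> C) (Phi0 : 'rV['F_p]_d -> C) (delta : C) :
  prime p -> (0 < k t)%N -> (k t <= kk)%N ->
  ((1 < k t)%N -> forall i, exists v : 'rV['F_p]_d, v 0 t = 1 /\ form_eval (L i) v = 0) ->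
  (forall i x, `|f i x| <= 1) ->
  (forall y c, Phi0 (y + c *: delta_mx 0 t) = Phi0 y) -> (forall y, `|Phi0 y| <= 1) ->
  0 <= delta -> delta <= 1 -> p%:R^-1 <= delta ^+ (2 ^ m.+2) ->
  `|\sum_(y : 'rV['F_p]_d) ((pow_count (k t) (y 0 t))%:R - 1) *
      (Phi0 y * \prod_(i < m) f i (form_eval (L i) y))|
    <= (k t * char_const m kk)%:R * delta * (p ^ d)%:R.
Proof.
move=> pr_p k_gt0 le_k exv f_le1 inv0 le0 d_ge0 d_le1 le_d.
have cardF : #|'F_p| = p := card_Fp pr_p.
have p_gt1 := prime_gt1 pr_p.
have [g prim_g] := finField_prim_root 'F_p.
have [W prim_W] : exists W : C, #|'F_p|.-1.-primitive_root W.
  by apply: closedField_prim_root; rewrite cardF; case: (p) p_gt1 => [|[]].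
have [k1|k_neq1] := eqVneq (k t) 1%N.
  rewrite big1 ?normr0 ?mulr_ge0 // => y _.
  rewrite k1 (_ : pow_count 1 (y 0 t) = 1%N) ?subrr ?mul0r //.
  by rewrite -[RHS](cards1 (y 0 t)); apply: eq_card => x; rewrite !inE expr1.
have k_gt1 : (1 < k t)%N by rewrite ltn_neqAle eq_sym k_neq1.
under eq_bigr => y _ do rewrite (pow_count_sub1 prim_g prim_W k_gt0) mulr_suml.
rewrite exchange_big /=; apply: le_trans (ler_norm_sum _ _ _) _.
apply: (@le_trans _ _ (\sum_(r < #|'F_p|.-1 | ((W ^+ r) ^+ k t == 1) && (W ^+ r != 1))
    (char_const m kk)%:R * delta * (p ^ d)%:R)).
  apply: ler_sum => r /andP[/eqP Wk W_neq1].
  have Wn : (W ^+ r) ^+ #|'F_p|.-1 = 1 by rewrite exprAC (prim_expr_order prim_W) expr1n.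
  have [K prim_K dvd_Kk] := prim_order_exists k_gt0 Wk.
  have K_gt1 : (1 < K)%N.
    rewrite ltn_neqAle (prim_order_gt0 prim_K) andbT eq_sym.
    by apply: contraNneq W_neq1 => K1; rewrite -(prim_expr_order prim_K) K1 expr1.
  apply: (@mchar_form_bound _ _ _ _ _ K) => //.
  - by move: prim_g; rewrite cardF.
  - have : (K %| #|'F_p|.-1)%N by rewrite (prim_order_dvd prim_K) Wn.
    by rewrite cardF.
  - by apply: leq_trans (dvdn_leq k_gt0 dvd_Kk) le_k.
  exact: exv.
rewrite sumr_const -[X in X <= _]mulr_natl natrM -!mulrA ler_wpM2r ?mulr_ge0 //.
by rewrite ler_nat; apply: card_pow_chars prim_g prim_W k_gt0.
Qed.

(** The saving is kept as a parameter delta, about p^(-1/2^(m + 2)), so that no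
    real powers are needed before the last step. *)
Lemma pow_equidistribution (C : numClosedFieldType) (m d : nat)
    (L : 'I_m -> 'rV[int]_d) (k : 'I_d -> nat) :
  (forall j, (0 < k j)%N) ->
  (forall j, (1 < k j)%N -> forall i a, L i <> a *: delta_mx 0 j) ->
  exists c p0 : nat, forall p, prime p -> (p0 <= p)%N ->
    forall (f : 'I_m -> 'F_p -> C) (delta : C),
    (forall i x, `|f i x| <= 1) ->
    0 <= delta -> delta <= 1 -> p%:R^-1 <= delta ^+ (2 ^ m.+2) ->
    `|\sum_(x : 'rV['F_p]_d) \prod_(i < m) f i (form_eval (L i) (coord_pow k x))
      - \sum_(x : 'rV['F_p]_d) \prod_(i < m) f i (form_eval (L i) x)|
      <= c%:R * delta * (p ^ d)%:R.
Proof.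
move=> k_gt0 L_not_axis.
pose kk := (\sum_j k j)%N; pose P t := (\prod_(j < d | (j < t)%N) k j)%N.
exists (\sum_(t < d) P t * (k t * char_const m kk))%N.
exists (\sum_i \sum_j `|L i 0%R j|).+1%N => p pr_p le_p f delta f_le1 d_ge0 d_le1 le_d.
have lt_coef i j : (`|L i 0%R j| < p)%N.
  apply: leq_trans le_p; rewrite ltnS (bigD1 i) //= (bigD1 j) //=.
  by rewrite -addnA leq_addr.
pose G (y : 'rV['F_p]_d) := \prod_(i < m) f i (form_eval (L i) y).
rewrite (sum_coord_pow k G) -sumrB.
under eq_bigr => y _ do
  rewrite -/(G y) -[X in _ - X]mul1r -mulrBl prod_sub1_telescope mulr_suml.
rewrite exchange_big /=; apply: le_trans (ler_norm_sum _ _ _) _.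
rewrite natr_sum !mulr_suml; apply: ler_sum => t _.
(* The weights of the earlier coordinates, normalized to be at most 1. *)
pose Phi0 (y : 'rV['F_p]_d) : C :=
  \prod_(j < d | (j < t)%N) ((pow_count (k j) (y 0 j))%:R / (k j)%:R).
have kR_neq0 j : (k j)%:R != 0 :> C by rewrite pnatr_eq0 -lt0n.
have splitE (y : 'rV['F_p]_d) :
    \prod_(j < d | (j < t)%N) (pow_count (k j) (y 0 j))%:R = (P t)%:R * Phi0 y.
  rewrite natr_prod -big_split /=; apply: eq_bigr => j _.
  by rewrite mulrCA mulfV ?mulr1.
rewrite (eq_bigr (fun y : 'rV['F_p]_d => (P t)%:R *
   (((pow_count (k t) (y 0 t))%:R - 1) * (Phi0 y * G y)))); last first.
  by move=> y _; rewrite splitE -!mulrA; congr (_ * _); rewrite mulrCA.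
rewrite -mulr_sumr normrM normr_nat natrM -!mulrA ler_wpM2l // !mulrA.
apply: pow_term_bound => //.
- by rewrite /kk (bigD1 t) //= leq_addr.
- move=> kt_gt1 i.
  have [j ne_jt Lj] : exists2 j, j != t & L i 0 j != 0.
    have [/existsP[j /andP[ne_j Lj]]|/existsPn no_j] :=
      boolP [exists j, (j != t) && (L i 0 j != 0)]; first by exists j.
    case: (L_not_axis t kt_gt1 i (L i 0 t)); apply/rowP => j; rewrite !mxE eqxx /=.
    have [->|ne_j] := eqVneq j t; first by rewrite mulr1.
    by rewrite mulr0; apply/eqP; have := no_j j; rewrite ne_j negbK.
  exact: form_eval_kernel pr_p (lt_coef i j) Lj ne_jt.
- move=> y c; apply: eq_bigr => j lt_jt; rewrite !mxE eqxx /=.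
  by rewrite -val_eqE /= ltn_eqF // mulr0 addr0.
move=> y; rewrite normr_prod; apply: prodr_ile1 => j _.
rewrite normr_ge0 ger0_norm ?divr_ge0 //=.
by rewrite ler_pdivrMr ?ltr0n ?k_gt0 // mul1r ler_nat pow_count_le.
Qed.

Local Open Scope complex_scope.

Theorem theorem5 (R : realType) (m d : nat)
  (L : 'I_m -> 'rV[int]_d) (k : 'I_d -> nat)
  (L_indep : pairwise_lin_indep L)
  (k_gt0 : forall j : 'I_d, (0 < k j)%N)
  (L_not_axis : forall j : 'I_d, (1 < k j)%N ->
     forall (i : 'I_m) (a : int), L i <> a *: delta_mx 0 j) :
  exists (c C : R) (p0 : nat), 0 < c /\
    forall p : nat, prime p -> (p0 <= p)%N ->
      (forall f : 'I_m -> 'F_p -> R[i],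
         (forall (i : 'I_m) (x : 'F_p), `|f i x| <= 1) ->
         `| expectation (fun x : 'rV['F_p]_d =>
              \prod_(j < m) f j (form_eval (L j) (coord_pow k x)))
          - expectation (fun x : 'rV['F_p]_d =>
              \prod_(j < m) f j (form_eval (L j) x)) |
         <= (C * p%:R `^ (- c))%:C)
      /\
      (forall A : {set 'F_p},
         `| #|[set x : 'rV['F_p]_d |
               [forall i : 'I_m, form_eval (L i) (coord_pow k x) \in A]]|%:R
          - #|[set x : 'rV['F_p]_d |
               [forall i : 'I_m, form_eval (L i) x \in A]]|%:R |
         <= C * p%:R `^ (d%:R - c)).
Proof.
have [C0 [p0 bound]] := @pow_equidistribution R[i] m d L k k_gt0 L_not_axis.
exists ((2 ^ m.+2)%:R^-1), C0%:R, p0; set c : R := _^-1.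
have N_gt0 : 0 < (2 ^ m.+2)%:R :> R by rewrite ltr0n expn_gt0.
have c_gt0 : 0 < c by rewrite invr_gt0.
split=> // p pr_p le_p.
have p_gt1 := prime_gt1 pr_p; have p_gt0 := prime_gt0 pr_p.
pose delta : R := p%:R `^ (- c).
have d_ge0 : 0 <= delta by apply: powR_ge0.
have d_le1 : delta <= 1.
  rewrite -(powRr0 (p%:R : R)) ler_powR ?oppr_le0 ?(ltW c_gt0) //.
  by rewrite ler1n.
have le_d : p%:R^-1 <= delta%:C ^+ (2 ^ m.+2) :> R[i].
  have -> : p%:R^-1 = (p%:R^-1 : R)%:C by rewrite fmorphV rmorph_nat.
  rewrite -rmorphXn lecR -powR_mulrn // -powRrM mulNr /c mulVf ?gt_eqF //.
  by rewrite powR_inv1 // ler0n.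
have dC_ge0 : 0 <= delta%:C :> R[i] by rewrite -(rmorph0 (real_complex R)) lecR.
have dC_le1 : delta%:C <= 1 :> R[i] by rewrite -(rmorph1 (real_complex R)) lecR.
have {}bound f f_le1 := bound p pr_p le_p f delta%:C f_le1 dC_ge0 dC_le1 le_d.
have pd_gt0 : 0 < (p ^ d)%:R :> R[i] by rewrite ltr0n expn_gt0 p_gt0.
split=> [f f_le1 | A].
  rewrite /expectation card_mx card_Fp // mul1n -mulrBr normrM.
  rewrite ger0_norm ?invr_ge0 ?ler0n // mulrC ler_pdivrMr //.
  by rewrite rmorphM rmorph_nat; apply: bound.
pose f (i : 'I_m) (x : 'F_p) : R[i] := (x \in A)%:R.
have f_le1 i x : `|f i x| <= 1 by rewrite /f; case: (x \in A); rewrite ?normr1 ?normr0.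
have cardE (h : 'I_m -> 'rV['F_p]_d -> 'F_p) :
    \sum_x \prod_(i < m) f i (h i x) = #|[set x | [forall i, h i x \in A]]|%:R.
  rewrite -sum1_card natr_sum [RHS]big_mkcond /=; apply: eq_bigr => x _.
  rewrite inE; case: ifPn => [/forallP inA|/forallPn[i niA]].
    by apply: big1 => i _; rewrite /f inA.
  by rewrite (bigD1 i) //= /f (negPf niA) mul0r.
have norm_real (x : R) : `|x%:C| = `|x|%:C by rewrite normc_def /= expr0n addr0 sqrtr_sqr.
have := bound f f_le1.
rewrite (cardE (fun i x => form_eval (L i) (coord_pow k x))).
rewrite (cardE (fun i x => form_eval (L i) x)).
rewrite powRD; last by rewrite pnatr_eq0 -lt0n p_gt0 implybT.
rewrite powR_mulrn ?ler0n // -natrX [_ * delta]mulrC mulrA -lecR -norm_real.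
by rewrite rmorphB !rmorphM !rmorph_nat /= mulrAC.
Qed.
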